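(* Let $X$ be a real Hilbert space, let $A\colon X\rightrightarrows X$ be a maximally monotone operator, and let $x,x^*\in X$. Then the following hold: (i) If $x\notin\overline{\operatorname{dom}}\,A$, then $\lim_{\gamma\to 0^+} C_{A,\gamma}(x,x^* )=+\infty$. (ii) If $x\in\operatorname{dom} A$, then $\lim_{\gamma\to 0^+} C_{A,\gamma}(x,x^* )=0$.
   Context: For $\gamma>0$, $J_{\gamma A}=(\mathrm{Id}+\gamma A)^{-1}$ denotes the resolvent of $\gamma A$, which is a single-valued map defined on all of $X$. The Carlier bound is $$C_{A,\gamma}(x,x^* ) := \frac{\|x-J_{\gamma A}(x+\gamma x^* )\|^2}{\gamma}.$$ $\operatorname{dom}A=\{x\in X: Ax\neq\varnothing\}$ and $\overline{\operatorname{dom}}\,A$ is its norm closure. *)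

(* Defs.v *)
From HB Require Import structures.
From mathcomp Require Import all_boot all_order all_algebra.
From mathcomp Require Import all_classical all_reals all_analysis.

Set Implicit Arguments.
Unset Strict Implicit.
Unset Printing Implicit Defensive.

Import Order.TTheory GRing.Theory Num.Theory.
Import numFieldNormedType.Exports.

Local Open Scope classical_set_scope.
Local Open Scope ring_scope.

(* A real Hilbert space is a complete normed module [X] over a [realType],
   together with a positive definite symmetric bilinear form [ip] such that
   [inner_product_norm ip] holds. *)
Definition inner_product_norm (R : realType) (X : normedModType R)
    (ip : {dot X for idfun}) : Prop :=
  forall x : X, `|x| ^+ 2 = ip x x.

(* A set-valued operator on [X] is a function [A : X -> set X]; [A x u] says
   that [(x, u)] belongs to its graph. *)

Definition monotone (R : realType) (X : normedModType R)
    (ip : {dot X for idfun}) (A : X -> set X) : Prop :=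
  forall x y u v : X, A x u -> A y v -> 0 <= ip (x - y) (u - v).

Definition maximally_monotone (R : realType) (X : normedModType R)
    (ip : {dot X for idfun}) (A : X -> set X) : Prop :=
  monotone ip A /\
  forall B : X -> set X, monotone ip B -> (forall x, A x `<=` B x) -> B = A.

Definition dom (X : Type) (A : X -> set X) : set X := [set x | A x !=set0].

Definition inverse_op (X : Type) (A : X -> set X) : X -> set X :=
  fun u => [set x | A x u].

Definition id_plus_scale (R : realType) (X : normedModType R)
    (gamma : R) (A : X -> set X) : X -> set X :=
  fun y => [set y + gamma *: v | v in A y].

(* For [0 < gamma] and [A] maximally monotone on a Hilbert space, the set
   [inverse_op (id_plus_scale gamma A) z] is a singleton by Minty's theorem,
   and [resolvent gamma A z] is its element. The default value 0 is only used
   outside that setting, when this set is empty. *)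
Definition resolvent (R : realType) (X : normedModType R)
    (gamma : R) (A : X -> set X) (z : X) : X :=
  xget 0 (inverse_op (id_plus_scale gamma A) z).

Definition carlier (R : realType) (X : normedModType R)
    (A : X -> set X) (gamma : R) (x xstar : X) : R :=
  `|x - resolvent gamma A (x + gamma *: xstar)| ^+ 2 / gamma.

(* Main.v *)
(* Let [p] be the resolvent at [x + g x']. Then [x' + (x - p)/g] lies in [A p].
   Off the closure of the domain, [|x - p|] stays above the distance from [x] to
   [dom A], so the bound is at least [r^2 / g]. If [u] is in [A x], monotonicity
   gives [|x - p| <= g |u - x'|], so the bound is at most [g |u - x'|^2].
   Both need the resolvent to be defined, which is Minty's theorem. With [F] the
   Fitzpatrick function of [A], [2 F(z) + |z|^2] is strongly convex and lower
   semicontinuous on [X * X], so by completeness it has a minimizer; the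
   variational inequality there, together with [F(w, w') >= <w, w'>], shows that
   the minimizer lies on the graph of [A] and that its components sum to 0. *)
Require Import Defs.
From mathcomp Require Import all_boot all_order all_algebra.
From mathcomp Require Import all_classical all_reals all_analysis.
From mathcomp Require Import ring lra.

Import Order.TTheory GRing.Theory Num.Theory.
Import numFieldNormedType.Exports.

Local Open Scope classical_set_scope.
Local Open Scope ring_scope.

(** * Inner product identities and a convergence criterion *)

Section inner_product.
Set Implicit Arguments.
Unset Strict Implicit.
Context {R : realType} {X : normedModType R} (ip : {dot X for idfun}).
Hypothesis hip : inner_product_norm ip.

Lemma ipC (x y : X) : ip x y = ip y x.
Proof. by rewrite hermC expr0 mul1r. Qed.

Lemma ipDl (x y z : X) : ip (x + y) z = ip x z + ip y z.
Proof. exact: linearDl. Qed.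

Lemma ipNl (x z : X) : ip (- x) z = - ip x z.
Proof. exact: linearNl. Qed.

Lemma ipZl (a : R) (x z : X) : ip (a *: x) z = a * ip x z.
Proof. exact: linearZl_LR. Qed.

Lemma ipDr (x y z : X) : ip z (x + y) = ip z x + ip z y.
Proof. exact: linearDr. Qed.

Lemma ipNr (x z : X) : ip z (- x) = - ip z x.
Proof. exact: linearNr. Qed.

Lemma ipZr (a : R) (x z : X) : ip z (a *: x) = a * ip z x.
Proof. by rewrite ipC ipZl ipC. Qed.

Definition ipE := (ipDl, ipDr, ipNl, ipNr, ipZl, ipZr).

(** The last term is the source of all strong convexity below. *)
Lemma sqr_norm_convex (a b : X) (t : R) :
  `|(1 - t) *: a + t *: b| ^+ 2 =
  (1 - t) * `|a| ^+ 2 + t * `|b| ^+ 2 - t * (1 - t) * `|a - b| ^+ 2.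
Proof. by rewrite !hip !ipE (ipC b a); ring. Qed.

End inner_product.

(** The bound is what midpoint strong convexity yields for a sequence minimizing up to [1/(n+1)]; it
    makes [u] Cauchy. *)
Lemma sqr_dist_cvgn {R : realType} {X : completeNormedModType R}
    (u : nat -> X) :
  (forall n k, `|u n - u k| ^+ 2 <= 2 * (n.+1%:R^-1 + k.+1%:R^-1)) ->
  cvgn u.
Proof.
move=> h; apply/cauchy_cvgP/cauchy_exP => e e0.
have d0 : 0 < e ^+ 2 / 4 by rewrite divr_gt0// exprn_gt0.
have [N _ HN] := near_infty_natSinv_lt (PosNum d0).
exists (u N); exists N => // n /= Nn.
rewrite -ball_normE /ball_ /= -(@ltr_pXn2r _ 2) ?nnegrE ?(ltW e0)//.
apply: le_lt_trans (h N n) _.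
have : N.+1%:R^-1 < e ^+ 2 / 4 by exact: (HN N (leqnn N)).
have : n.+1%:R^-1 < e ^+ 2 / 4 by exact: (HN n Nn).
by move: N.+1%:R^-1 n.+1%:R^-1 => a b; lra.
Qed.

(** * Minimizing the Fitzpatrick function *)

Section minty.
Set Implicit Arguments.
Unset Strict Implicit.
Context {R : realType} {X : completeNormedModType R} (ip : {dot X for idfun}).
Hypothesis hip : inner_product_norm ip.
Variable A : X -> set X.
Hypothesis Amono : Defs.monotone ip A.
Hypothesis Amax : forall p u,
  (forall y v, A y v -> 0 <= ip (p - y) (u - v)) -> A p u.

(* If [F] is the Fitzpatrick function of [A], this says that
   [2 F(-a, -b) + |a|^2 + |b|^2 <= s]. *)
Definition fitzpatrick_le (a b : X) (s : R) :=
  forall y v, A y v -> `|v - a| ^+ 2 + `|y - b| ^+ 2 <= s + `|y + v| ^+ 2.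

(** This is [F(w, w') >= <w, w'>] at [(-a, -b)]: on the graph, test the point against itself; off
    it, against a graph point that violates monotonicity. *)
Lemma fitzpatrick_ge (a b : X) (s : R) :
  fitzpatrick_le a b s -> `|a + b| ^+ 2 <= s.
Proof.
move=> h; have [AN|nAN] := pselect (A (- a) (- b)).
  have := h _ _ AN; rewrite -!opprD !normrN addrC.
  by rewrite (addrC b a); lra.
have /existsNP[y /existsNP[v /not_implyP[Ayv /negP]]] :
    ~ forall y v, A y v -> 0 <= ip (- a - y) (- b - v).
  by move=> /Amax.
rewrite -ltNge; have := h _ _ Ayv.
rewrite !hip !ipE // (ipC ip v a) (ipC ip b a) (ipC ip b y) (ipC ip v y); lra.
Qed.

(** Monotonicity gives [F(y, v) <= <y, v>] on the graph. *)
Lemma fitzpatrick_graph (y v : X) :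
  A y v -> fitzpatrick_le (- y) (- v) (`|y + v| ^+ 2).
Proof.
move=> Ayv z w Azw; have := Amono Ayv Azw.
rewrite !hip !ipE // (ipC ip w y) (ipC ip w z) (ipC ip v y) (ipC ip v z); lra.
Qed.

(** For each fixed graph point this is [sqr_norm_convex], and the quadratic gain does not depend on
    that point. *)
Lemma fitzpatrick_convex (a b a' b' : X) (s s' t : R) : 0 <= t <= 1 ->
  fitzpatrick_le a b s -> fitzpatrick_le a' b' s' ->
  fitzpatrick_le ((1 - t) *: a + t *: a') ((1 - t) *: b + t *: b')
    ((1 - t) * s + t * s' -
      t * (1 - t) * (`|a - a'| ^+ 2 + `|b - b'| ^+ 2)).
Proof.
move=> /andP[t0 t1] h h' y v Ayv.
have split (x c c' : X) : x - ((1 - t) *: c + t *: c') =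
    (1 - t) *: (x - c) + t *: (x - c').
  by rewrite !scalerBr addrACA -scalerDl subrK scale1r opprD.
have sub (x c c' : X) : `|x - c - (x - c')| = `|c - c'|.
  by rewrite opprB addrC addrA subrK distrC.
rewrite !split !(sqr_norm_convex hip) !sub.
have {h} := ler_wpM2l (_ : 0 <= 1 - t) (h _ _ Ayv); rewrite subr_ge0 => /(_ t1).
have := ler_wpM2l t0 (h' _ _ Ayv).
lra.
Qed.

Lemma fitzpatrick_min : exists a b m, fitzpatrick_le a b m /\
  forall a' b' s, fitzpatrick_le a' b' s -> m <= s.
Proof.
pose S : set R := [set s | exists a b, fitzpatrick_le a b s].
have [y0 [v0 A0]] : exists y v, A y v.
  have [//|nA] := pselect (exists y v, A y v).
  (* For an empty graph, [Amax] would hold vacuously at [(0, 0)]. *)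
  by exists 0, 0; apply: Amax => y v Ayv; case: nA; exists y, v.
have lS : lbound S 0.
  by move=> s [a [b h]]; apply: le_trans (fitzpatrick_ge h); rewrite sqr_ge0.
have hS : has_inf S.
  split; last by exists 0.
  by exists (`|y0 + v0| ^+ 2), (- y0), (- v0); apply: fitzpatrick_graph.
have mS a b s : fitzpatrick_le a b s -> inf S <= s.
  by move=> h; apply: ge_inf; [exact: hS.2|exists a, b].
have /choice[w hw] (n : nat) : exists c : X * X,
    fitzpatrick_le c.1 c.2 (inf S + n.+1%:R^-1).
  have [|s [a [b h]] ls] := @inf_adherent _ S n.+1%:R^-1 _ hS.
    by rewrite invr_gt0.
  by exists (a, b) => y v Ayv; apply: le_trans (h _ _ Ayv) _; rewrite lerD2r ltW.
(* The value at the midpoint of [w n] and [w k] is still at least the infimum. *)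
have wC n k : `|(w n).1 - (w k).1| ^+ 2 + `|(w n).2 - (w k).2| ^+ 2 <=
    2 * (n.+1%:R^-1 + k.+1%:R^-1).
  have t01 : 0 <= (2^-1 : R) <= 1 by lra.
  have /mS := fitzpatrick_convex t01 (hw n) (hw k).
  by move: n.+1%:R^-1 k.+1%:R^-1 => p q; lra.
have c1 : cvgn (fst \o w).
  apply: sqr_dist_cvgn => n k; apply: le_trans (wC n k).
  by rewrite lerDl sqr_ge0.
have c2 : cvgn (snd \o w).
  apply: sqr_dist_cvgn => n k; apply: le_trans (wC n k).
  by rewrite lerDr sqr_ge0.
exists (limn (fst \o w)), (limn (snd \o w)), (inf S); split=> // y v Ayv.
(* Lower semicontinuity: each constraint passes to the limit separately. *)
have cl : (`|v - (w n).1| ^+ 2 + `|y - (w n).2| ^+ 2 - n.+1%:R^-1) @[n --> \oo] -->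
   `|v - limn (fst \o w)| ^+ 2 + `|y - limn (snd \o w)| ^+ 2 - 0.
  apply: cvgB; last exact: cvg_harmonic.
  by apply: cvgD; rewrite expr2; under eq_fun do rewrite expr2;
    apply: cvgM; apply: cvg_norm; apply: cvgB => //; exact: cvg_cst.
rewrite subr0 in cl; rewrite -(cvg_lim _ cl)//.
apply: limr_le; first by apply/cvg_ex; eexists; exact: cl.
apply: nearW => n; have := hw n _ _ Ayv; move: n.+1%:R^-1 => p; lra.
Qed.

Lemma maxmono_zero_sum : exists p u, A p u /\ p + u = 0.
Proof.
have [a [b [m [h hm]]]] := fitzpatrick_min.
have mge := fitzpatrick_ge h.
have var y v : A y v -> m + (`|a + y| ^+ 2 + `|b + v| ^+ 2) <= `|y + v| ^+ 2.
  (* Move from the minimizer towards [(-y, -v)] by a small fraction [t]. *)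
  move=> Ayv; set Q := (X in m + X); set s := `|y + v| ^+ 2.
  have Q0 : 0 <= Q by rewrite addr_ge0 ?sqr_ge0.
  rewrite leNgt; apply/negP => lt.
  pose d := m + Q - s; have d0 : 0 < d by rewrite /d; lra.
  have D0 : 0 < Q + 2 * d by lra.
  (* Minimality will give [m + (1 - t) * Q <= s], but for this [t] the left side equals
     [s + 2 * t * d]. *)
  pose t := d / (Q + 2 * d).
  have t0 : 0 < t by rewrite divr_gt0.
  have t1 : t <= 1 by rewrite ler_pdivrMr //; lra.
  have tQ : t * (Q + 2 * d) = d by rewrite divfK // gt_eqF.
  have t01 : 0 <= t <= 1 by rewrite ltW.
  have /hm := fitzpatrick_convex t01 h (fitzpatrick_graph Ayv).
  rewrite !opprK -/Q -/s => le.
  have : t * (m + (1 - t) * Q) <= t * s by lra.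
  rewrite ler_pM2l // => le2.
  have : 0 < t * d by rewrite mulr_gt0.
  by rewrite /d in tQ *; lra.
(* Adding [mge] to [var] gives [<b - y, a - v> >= |a + b|^2]. *)
have Aba : A b a.
  apply: Amax => y v Ayv; have := var y v Ayv.
  have : 0 <= `|a + b| ^+ 2 by rewrite sqr_ge0.
  move: mge; rewrite !hip !ipE // (ipC ip b a) (ipC ip y a) (ipC ip v b).
  by rewrite (ipC ip v y); lra.
exists b, a; split=> //; rewrite addrC; apply/eqP.
rewrite -normr_eq0 -sqrf_eq0 eq_le sqr_ge0 andbT.
(* At the graph point [(b, a)] itself, [var] and [mge] force [|a + b|^2 <= 0]. *)
by have := var _ _ Aba; rewrite (addrC b a); lra.
Qed.

End minty.

(** * Minty's theorem and the upper bound on the domain *)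

Section resolvent.
Set Implicit Arguments.
Unset Strict Implicit.
Context {R : realType} {X : completeNormedModType R} (ip : {dot X for idfun}).
Hypothesis hip : inner_product_norm ip.
Variable A : X -> set X.
Hypothesis hA : maximally_monotone ip A.

(** Adjoining [(p, u)] to the graph keeps it monotone, so maximality absorbs the point. *)
Lemma maximally_monotone_graph (p u : X) :
  (forall y v, A y v -> 0 <= ip (p - y) (u - v)) -> A p u.
Proof.
move=> h; have [mA maxA] := hA.
pose B x := A x `|` [set z | x = p /\ z = u].
have <- : B = A; last by right.
apply: maxA; last by move=> x z Axz; left.
move=> x y z w [Axz|[-> ->]] [Ayw|[-> ->]].
- exact: mA.
- have := h _ _ Axz; rewrite -(opprB x p) -(opprB z u).
  by rewrite !(ipNl, ipNr) opprK.
- exact: h.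
- by rewrite !subrr -hip sqr_ge0.
Qed.

Lemma minty (gamma : R) (z : X) : 0 < gamma ->
  exists2 v, A (resolvent gamma A z) v & resolvent gamma A z + gamma *: v = z.
Proof.
move=> g0; have gN0 : gamma != 0 by rewrite gt_eqF.
(* Once a solution exists, [xget] returns one rather than its default 0. *)
suff [p [v [Apv pv]]] : exists p v, A p v /\ p + gamma *: v = z.
  have [w Aw rw] : inverse_op (id_plus_scale gamma A) z (resolvent gamma A z).
    by apply: xgetPex; exists p; exists v.
  by exists w.
(* A zero-sum point of the graph of [B] is exactly a solution of [p + gamma *: v = z]. *)
pose B y : set X := [set gamma *: v - z | v in A y].
have [||p [_ [[v Apv <-]]]] := @maxmono_zero_sum R X ip hip B.
- move=> x y _ _ [u Axu <-] [v Ayv <-].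
  rewrite opprB addrA subrK -scalerBr ipZr mulr_ge0 ?(ltW g0) //.
  exact: hA.1.
- move=> p u h; exists (gamma^-1 *: (u + z)); last first.
    by rewrite scalerA mulfV // scale1r addrK.
  apply: maximally_monotone_graph => y v Ayv.
  have := h y (gamma *: v - z) (ex_intro2 _ _ v Ayv erefl).
  rewrite opprB => h'.
  have -> : gamma^-1 *: (u + z) - v = gamma^-1 *: (u + (z - gamma *: v)).
    by rewrite addrA scalerBr scalerA mulVf // scale1r.
  rewrite ipZr mulr_ge0 ?invr_ge0 ?(ltW g0) //.
by rewrite addrA => /eqP; rewrite subr_eq0 => /eqP <-; exists p, v.
Qed.

Lemma carlier_le (gamma : R) (x xstar u : X) : 0 < gamma -> A x u ->
  carlier A gamma x xstar <= gamma * `|u - xstar| ^+ 2.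
Proof.
move=> g0 Axu; rewrite /carlier.
have [v] := minty (x + gamma *: xstar) g0.
set p := resolvent _ _ _ => Apv pv.
have xp : x - p = gamma *: (v - xstar).
  by rewrite scalerBr; apply/eqP; rewrite subr_eq -addrAC eq_sym subr_eq addrC pv.
have := hA.1 _ _ _ _ Axu Apv; rewrite xp ipZl pmulr_rge0 // => h.
(* With [a = v - xstar] and [b = u - xstar], [h] reads [<a, b - a> >= 0]; combine it with
   [|b - a|^2 >= 0]. *)
have le : `|v - xstar| ^+ 2 <= `|u - xstar| ^+ 2.
  have := sqr_ge0 `|(u - xstar) - (v - xstar)|; move: h.
  rewrite -[in u - v](subrK xstar u) -[in _ - v](subrK xstar v).
  rewrite opprD addrACA subrr addr0.
  rewrite !hip; move: (v - xstar) (u - xstar) => a b.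
  by rewrite !ipE (ipC ip b a); lra.
rewrite normrZ gtr0_norm // ler_pdivrMr // exprMn [leRHS]mulrAC -expr2.
by rewrite ler_pM2l // exprn_gt0.
Qed.

End resolvent.

Theorem theorem5p1 (R : realType) (X : completeNormedModType R)
    (ip : {dot X for idfun}) (hip : inner_product_norm ip)
    (A : X -> set X) (hA : maximally_monotone ip A) (x xstar : X) :
  (~ closure (dom A) x ->
     carlier A gamma x xstar @[gamma --> 0^'+] --> +oo) /\
  (dom A x ->
     carlier A gamma x xstar @[gamma --> 0^'+] --> (0 : R)).
Proof.
split=> [nx|[u Axu]].
  have [r r0 rA] : exists2 r : R, 0 < r & forall y, dom A y -> r <= `|x - y|.
    (* Without such an [r], every ball around [x] would meet the domain. *)
    apply: contrapT => nr; apply: nx => B /nbhs_ballP[r /= r0 rB].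
    apply: contrapT => nB; apply: nr; exists r => // y Ay.
    rewrite leNgt; apply/negP => xy; apply: nB; exists y; split=> //.
    by apply: rB; rewrite -ball_normE.
  apply/cvgryPge => M; near=> g.
  have g0 : 0 < g by [].
  have [v Apv _] := minty hip hA (x + g *: xstar) g0.
  have /rA le : dom A (resolvent g A (x + g *: xstar)) by exists v.
  rewrite /carlier ler_pdivlMr //.
  apply: (@le_trans _ _ (r ^+ 2)); last by rewrite ler_pXn2r ?nnegrE ?(ltW r0).
  (* [|M| + 1] is a positive upper bound of [M], whatever its sign, so it can be a divisor. *)
  have M1 : 0 < `|M| + 1 by rewrite ltr_wpDl.
  have : g < r ^+ 2 / (`|M| + 1).
    near: g; apply: nbhs_right_lt; rewrite divr_gt0 // exprn_gt0 //.
  rewrite ltr_pdivlMr // => h; apply: le_trans (ltW h).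
  rewrite mulrC ler_pM2l //; have := ler_norm M; lra.
apply: (@squeeze_cvgr _ _ _ _ (fun=> 0) (fun g => g * `|u - xstar| ^+ 2)).
- near=> g; have g0 : 0 < g by [].
  by rewrite (carlier_le hip hA) // andbT /carlier divr_ge0 ?sqr_ge0.
- exact: cvg_cst.
- rewrite -[X in _ --> X](mul0r (`|u - xstar| ^+ 2)).
  apply: cvgM; last exact: cvg_cst.
  exact/cvg_at_right_filter/cvg_id.
Unshelve. all: by end_near.
Qed.
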